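(* Let $0\le\mu<L<\infty$, $\delta\in[0,1)$, $\epsilon\in\left(0,\frac{1-\delta}{(1+\delta)^2}\right)$ and $\eta>1$. Let $f:\mathbb R^n\to\mathbb R$ be a $(\mu,L)$-smooth function with global minimizer $\mathbf x_*$ and let $\{\mathbf x_k\}_{k\ge1}$ be any sequence of iterates generated using noisy gradient descent with Armijo-terminated line search (with noise level $\delta$ and parameters $\epsilon,\eta$). Then for every $k\ge 1$ the bound $$f_{k+1}-f_*\le\left[1-\frac{4\mu\epsilon(1-\delta)^2}{\eta L}\left(\frac{1-\delta}{(1+\delta)^2}-\epsilon\right)\right](f_k-f_* )$$ holds and admits an SOS certificate of degree 1 with respect to the valid constraints $h_1(\mathbf z)\ge0,\dots,h_7(\mathbf z)\ge0$ defined in the context.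
   Context: Notation: $f_i=f(\mathbf x_i)$ and $\mathbf g_i=\nabla f(\mathbf x_i)$ for $i\in\{k,k+1,*\}$; $\|\cdot\|$ is the Euclidean norm. Since $\mathbf x_*$ is a global minimizer, $\mathbf g_*=0$. $(\mu,L)$-smooth function: a convex differentiable $f:\mathbb R^n\to\mathbb R$ with $\|\nabla f(\mathbf x)-\nabla f(\mathbf y)\|\le L\|\mathbf x-\mathbf y\|$ for all $\mathbf x,\mathbf y$ ($L$-smooth) and $f(\mathbf x)-\frac\mu2\|\mathbf x\|^2$ convex ($\mu$-strongly convex). Noisy gradient descent with noise level $\delta$: $\mathbf x_{k+1}=\mathbf x_k+\gamma_k\mathbf d_k$, where $\gamma_k>0$ and the direction $\mathbf d_k\in\mathbb R^n$ satisfies $\|\mathbf d_k-(-\mathbf g_k)\|\le\delta\|\mathbf g_k\|$. Armijo-terminated line search (noisy setting): the step size $\gamma_k$ satisfies $$f(\mathbf x_k+\gamma_k\mathbf d_k)\le f(\mathbf x_k)-\epsilon\gamma_k\|\mathbf d_k\|^2,\qquad f(\mathbf x_k+\eta\gamma_k\mathbf d_k)\ge f(\mathbf x_k)-\epsilon\eta\gamma_k\|\mathbf d_k\|^2 .$$ Constraint polynomials: let $\mathbf z=(f_*,f_k,f_{k+1},\mathbf x_*,\mathbf x_k,\mathbf x_{k+1},\mathbf g_*,\mathbf g_k,\mathbf g_{k+1})$, regarded as formal variables with $\mathbf g_*=0$ substituted. For $(i,j)$ put $$h_{(i,j)}(\mathbf z)=f_i-f_j-\mathbf g_j^\top(\mathbf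 x_i-\mathbf x_j)-\frac{L}{2(L-\mu)}\left(\frac1L\|\mathbf g_i-\mathbf g_j\|^2+\mu\|\mathbf x_i-\mathbf x_j\|^2-2\frac\mu L(\mathbf g_j-\mathbf g_i)^\top(\mathbf x_j-\mathbf x_i)\right).$$ Then $h_1,\dots,h_6$ are $h_{(i,j)}$ for $(i,j)=(k,k+1),(k,* ),(k+1,k),(k+1,* ),( *,k),( *,k+1)$ respectively; the inequalities $h_1,\dots,h_6\ge0$ are the interpolability conditions satisfied by every $(\mu,L)$-smooth function. The seventh is $$h_7(\mathbf z)=f_k-f_{k+1}-\frac{2\epsilon(1-\delta)^2}{\eta L}\left(\frac{1-\delta}{(1+\delta)^2}-\epsilon\right)\|\mathbf g_k\|^2,$$ and the inequality $h_7\ge0$ is satisfied by the iterates of the method. The bound $f_{k+1}-f_*\le t(f_k-f_* )$ admits an SOS certificate of degree 1 if there are scalars $\sigma_1,\dots,\sigma_7\ge0$ and a polynomial $\sigma_0(\mathbf z)$ that is a sum of squares of polynomials of degree at most 1 such that, as an identity of polynomials in $\mathbf z$ (with $\mathbf g_*=0$), $$t(f_k-f_* )-(f_{k+1}-f_* )=\sigma_0(\mathbf z)+\sum_{i=1}^7\sigma_ih_i(\mathbf z).$$ *)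

(* Defs.v *)
(* mpoly is imported without its notations, which clash with those of
   MathComp-Analysis. *)
From HB Require Import structures.
From mathcomp Require Import all_boot all_order all_algebra.
From mathcomp Require Import all_classical all_reals all_analysis.
From mathcomp Require Import -(notations) mpoly.

Set Implicit Arguments.
Unset Strict Implicit.
Unset Printing Implicit Defensive.

Import Order.TTheory GRing.Theory Num.Theory.
Import numFieldNormedType.Exports.

Local Open Scope classical_set_scope.
Local Open Scope ring_scope.

(* Stated over a ring, so as to apply both to real vectors and to vectors of
   formal variables. *)
Definition dot (A : comNzRingType) (n : nat) (u v : 'rV[A]_n) : A :=
  \sum_(j < n) u 0 j * v 0 j.

(* The library norm `|u| on row vectors is the sup norm, not the Euclidean one. *)
Definition enorm (R : realType) (n : nat) (u : 'rV[R]_n) : R :=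
  Num.sqrt (dot u u).

Definition gradient (R : realType) (n : nat) (f : 'rV[R]_n -> R)
    (x : 'rV[R]_n) : 'rV[R]_n :=
  \row_(j < n) 'D_(delta_mx 0 j) f x.

Definition mu_L_smooth (R : realType) (n : nat) (mu L : R)
    (f : 'rV[R]_n -> R) : Prop :=
  [/\ @convex_function R 'rV[R]_n setT f,
      forall x, differentiable f x,
      forall x y, enorm (gradient f x - gradient f y) <= L * enorm (x - y)
    & @convex_function R 'rV[R]_n setT
        (fun x => f x - mu / 2 * enorm x ^+ 2)].

Definition noisy_gradient_step (R : realType) (n : nat) (delta : R)
    (f : 'rV[R]_n -> R) (x : 'rV[R]_n) (gamma : R) (d x' : 'rV[R]_n) : Prop :=
  [/\ 0 < gamma,
      enorm (d - (- gradient f x)) <= delta * enorm (gradient f x)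
    & x' = x + gamma *: d].

Definition armijo_terminated (R : realType) (n : nat) (eps eta : R)
    (f : 'rV[R]_n -> R) (x : 'rV[R]_n) (gamma : R) (d : 'rV[R]_n) : Prop :=
  f (x + gamma *: d) <= f x - eps * gamma * enorm d ^+ 2 /\
  f (x + (eta * gamma) *: d) >= f x - eps * eta * gamma * enorm d ^+ 2.

Definition label : finType := option bool.
Definition lstar : label := None.
Definition lk : label := Some false.
Definition lk1 : label := Some true.

(* Names of the scalar variables in z: inl i stands for f_i, inr (inl i, j) for
   the j-th coordinate of x_i, and inr (inr b, j) for the j-th coordinate of
   g_(Some b).  There is no variable for g_*, which is replaced by 0. *)
Definition zvar (n : nat) : finType :=
  (label + (label + bool) * 'I_n)%type.

Definition zpoly (R : realType) (n : nat) := mpoly #|zvar n| R.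

Definition zX (R : realType) (n : nat) (i : zvar n) : zpoly R n :=
  mpolyX R (mnm1 (enum_rank i)).

Section Constraints.
Variables (R : realType) (n : nat).

Definition fvar (i : label) : zpoly R n := zX R (inl i).

Definition xvar (i : label) : 'rV[zpoly R n]_n :=
  \row_(j < n) zX R (inr (inl i, j)).

Definition gvar (i : label) : 'rV[zpoly R n]_n :=
  if i is Some b then \row_(j < n) zX R (inr (inr b, j)) else 0.

Definition h_interp (mu L : R) (i j : label) : zpoly R n :=
  fvar i - fvar j - dot (gvar j) (xvar i - xvar j)
  - (L / (2 * (L - mu))) *:
      (L^-1 *: dot (gvar i - gvar j) (gvar i - gvar j)
       + mu *: dot (xvar i - xvar j) (xvar i - xvar j)
       - (2 * (mu / L)) *: dot (gvar j - gvar i) (xvar j - xvar i)).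

Definition h_armijo (L delta eps eta : R) : zpoly R n :=
  fvar lk - fvar lk1
  - (2 * eps * (1 - delta) ^+ 2 / (eta * L)
       * ((1 - delta) / (1 + delta) ^+ 2 - eps)) *: dot (gvar lk) (gvar lk).

Definition constraints (mu L delta eps eta : R) : 7.-tuple (zpoly R n) :=
  [tuple h_interp mu L lk lk1; h_interp mu L lk lstar;
         h_interp mu L lk1 lk; h_interp mu L lk1 lstar;
         h_interp mu L lstar lk; h_interp mu L lstar lk1;
         h_armijo L delta eps eta].

(* msize p is the degree of p plus one. *)
Definition sos_deg1 (p : zpoly R n) : Prop :=
  exists2 qs : seq (zpoly R n),
    forall q, q \in qs -> (msize q <= 2)%N & p = \sum_(q <- qs) q ^+ 2.

Definition sos_certificate_deg1 (h : 7.-tuple (zpoly R n)) (t : R) : Prop :=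
  exists (sigma : 'I_7 -> R) (sigma0 : zpoly R n),
    [/\ forall i, 0 <= sigma i,
        sos_deg1 sigma0
      & t *: (fvar lk - fvar lstar) - (fvar lk1 - fvar lstar)
        = sigma0 + \sum_(i < 7) sigma i *: tnth h i].

(* The values of the variables of z at the points pt; for g_* the value is the
   constant 0, which is gradient f (pt lstar) when pt lstar minimizes f. *)
Definition zvalue (f : 'rV[R]_n -> R) (pt : label -> 'rV[R]_n)
    (m : 'I_#|zvar n|) : R :=
  match enum_val m with
  | inl i => f (pt i)
  | inr (inl i, j) => pt i 0 j
  | inr (inr b, j) => gradient f (pt (Some b)) 0 j
  end.

Definition zpoints (xs xk xk1 : 'rV[R]_n) (i : label) : 'rV[R]_n :=
  match i with None => xs | Some false => xk | Some true => xk1 end.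

Definition valid_at (h : 7.-tuple (zpoly R n)) (f : 'rV[R]_n -> R)
    (xs xk xk1 : 'rV[R]_n) : Prop :=
  forall i, 0 <= meval (zvalue f (zpoints xs xk xk1)) (tnth h i).

End Constraints.

(* Main.v *)
Require Import Defs.
From mathcomp Require Import all_boot all_order all_algebra.
From mathcomp Require Import all_classical all_reals all_analysis.
From mathcomp Require Import -(notations) mpoly.
From mathcomp Require Import ring lra.

(** Write f_s and x_s for the minimum and the minimizer, and
    C = 2 eps (1 - delta)^2 / (eta L) * ((1 - delta) / (1 + delta)^2 - eps),
    so that the rate is t = 1 - 2 mu C.

    The certificate.  Adding and subtracting C |g_k|^2,
    t (f_k - f_s) - (f_{k+1} - f_s)
      = (f_k - f_{k+1} - C |g_k|^2) + C (|g_k|^2 - 2 mu (f_k - f_s)).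
    The first bracket is h_7.  The second one is the Polyak-Lojasiewicz
    inequality, and it comes from the interpolation inequality of the pair
    (s, k) by completing the square:
    |g_k|^2 - 2 mu (f_k - f_s)
      = 2 mu h_5 + L / (L - mu) * |g_k - mu (x_k - x_s)|^2.
    Hence the multipliers are sigma_5 = 2 mu C and sigma_7 = 1, and sigma_0 is
    a sum of n squares of linear forms ([armijo_certificate]).  Evaluating the
    identity at the iterates yields the bound ([certificate_sound]), once the
    seven constraints are known to hold there.

    The constraints h_1, ..., h_6 ([interpolation_ineq]).  A Lipschitz gradient
    squeezes f between two quadratics ([smooth_upper_bound],
    [smooth_lower_bound]), and strong convexity gives a quadratic minorant with
    curvature mu ([strong_convex_first_order]).  Comparing the minorant at x_j
    with the majorant at x_i, in the point that minimizes their difference,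
    gives the interpolation inequality.

    The constraint h_7 ([armijo_decrease]).  The test value at eta gamma_k is not
    below the Armijo threshold, so the upper bound along d_k forces
    gamma_k |d_k|^2 >= 2 / (eta L) * (- g_k . d_k - eps |d_k|^2).  The noise
    bound gives |d_k| <= (1 + delta) |g_k|, |d_k| >= (1 - delta) |g_k| and
    - g_k . d_k >= (1 - delta) |g_k|^2, and the accepted step decreases f by at
    least eps gamma_k |d_k|^2. *)

Set Implicit Arguments.
Unset Strict Implicit.
Unset Printing Implicit Defensive.

Import Order.TTheory GRing.Theory Num.Theory.
Import numFieldNormedType.Exports.

Local Open Scope ring_scope.

(** * The bilinear form [dot] over a commutative ring *)

Section DotRing.
Variables (A : comNzRingType) (n : nat).
Implicit Types (u v w : 'rV[A]_n) (a : A).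

Lemma dotC u v : dot u v = dot v u.
Proof. by apply: eq_bigr => j _; rewrite mulrC. Qed.

Lemma dotDl u v w : dot (u + v) w = dot u w + dot v w.
Proof. by rewrite -big_split; apply: eq_bigr => j _; rewrite mxE mulrDl. Qed.

Lemma dotZl a u v : dot (a *: u) v = a * dot u v.
Proof. by rewrite big_distrr; apply: eq_bigr => j _; rewrite mxE /= mulrA. Qed.

Lemma dotDr u v w : dot u (v + w) = dot u v + dot u w.
Proof. by rewrite !(dotC u) dotDl. Qed.

Lemma dotZr a u v : dot u (a *: v) = a * dot u v.
Proof. by rewrite !(dotC u) dotZl. Qed.

Lemma dotNl u v : dot (- u) v = - dot u v.
Proof. by rewrite -scaleN1r dotZl mulN1r. Qed.

Lemma dotNr u v : dot u (- v) = - dot u v.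
Proof. by rewrite !(dotC u) dotNl. Qed.

Lemma dot0l u : dot 0 u = 0.
Proof. by rewrite -(scale0r 0) dotZl mul0r. Qed.

Definition dotE := (dotDl, dotDr, dotNl, dotNr, dotZl, dotZr).

End DotRing.

Lemma rmorph_dot (A B : comNzRingType) (phi : {rmorphism A -> B}) n
    (u v : 'rV[A]_n) :
  phi (dot u v) = dot (map_mx phi u) (map_mx phi v).
Proof. by rewrite rmorph_sum; apply: eq_bigr => j _; rewrite rmorphM !mxE. Qed.

(** * Euclidean geometry of row vectors *)

Section Euclid.
Variables (R : realType) (n : nat).
Implicit Types u v : 'rV[R]_n.

Lemma dot_ge0 u : 0 <= dot u u.
Proof. by apply: sumr_ge0 => j _; rewrite -expr2 sqr_ge0. Qed.

Lemma dot_eq0 u : dot u u = 0 -> u = 0.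
Proof.
move=> /eqP; rewrite psumr_eq0 => [/allP u0|j _]; last by rewrite -expr2 sqr_ge0.
apply/rowP => j; rewrite mxE.
by have := u0 j (mem_index_enum _); rewrite -expr2 sqrf_eq0 => /eqP.
Qed.

Lemma enorm_ge0 u : 0 <= enorm u.
Proof. exact: sqrtr_ge0. Qed.

Lemma enorm_sqr u : enorm u ^+ 2 = dot u u.
Proof. by rewrite sqr_sqrtr ?dot_ge0. Qed.

Lemma enormN u : enorm (- u) = enorm u.
Proof. by rewrite /enorm !dotE opprK. Qed.

Lemma enormZ a u : 0 <= a -> enorm (a *: u) = a * enorm u.
Proof.
move=> a0; rewrite /enorm !dotE mulrA -expr2 sqrtrM ?sqr_ge0 //.
by rewrite sqrtr_sqr ger0_norm.
Qed.

(** Cauchy-Schwarz: expand the square of the component of u orthogonal to v,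
    scaled by |v|^2 to avoid a division. *)
Lemma dot_le_enorm u v : dot u v <= enorm u * enorm v.
Proof.
have [v0|vn0] := eqVneq (dot v v) 0.
  by rewrite (dot_eq0 v0) dotC dot0l mulr_ge0 ?enorm_ge0.
have vgt0 : 0 < dot v v by rewrite lt_def vn0 dot_ge0.
apply: le_trans (ler_norm _) _.
rewrite -(ler_pXn2r (isT : (0 < 2)%N)) ?nnegrE ?mulr_ge0 ?enorm_ge0 //.
rewrite real_normK ?num_real // exprMn !enorm_sqr -subr_ge0 -(pmulr_rge0 _ vgt0).
have := dot_ge0 (dot v v *: u - dot u v *: v).
rewrite !dotE (dotC v u) => H; apply: le_trans H _.
by rewrite le_eqVlt; apply/orP; left; apply/eqP; ring.
Qed.

End Euclid.

(** * Quadratic bounds for a function with Lipschitz gradient *)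

Section Smooth.
Variables (R : realType) (n : nat) (f : 'rV[R]_n -> R).
Implicit Types x y v : 'rV[R]_n.
Hypothesis fdiff : forall x, differentiable f x.

Lemma derive_gradient x v : 'D_v f x = dot (gradient f x) v.
Proof.
rewrite deriveE // {1}(row_sum_delta v) linear_sum; apply: eq_bigr => j _.
by rewrite mxE deriveE // linearZ /= mulrC.
Qed.

Lemma is_derive_line x v (s : R) :
  is_derive s 1 (fun t : R => f (x + t *: v)) (dot (gradient f (x + s *: v)) v).
Proof.
rewrite -derive_gradient.
(* Both derivatives are limits of the same difference quotient. *)
have E : (fun h : R => h^-1 *: (((fun t : R => f (x + t *: v)) \o shift s) (h *: 1)
           - f (x + s *: v))) =
         (fun h : R => h^-1 *: ((f \o shift (x + s *: v)) (h *: v) - f (x + s *: v))).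
  apply/funext => h /=; congr (_ *: (f _ - _)).
  by rewrite /= scalerDl /GRing.scale /= mulr1 addrCA.
split; rewrite /derivable /derive E //.
exact: (diff_derivable (fdiff (x + s *: v))).
Qed.

(** Mean value theorem on [0, 1] for f (x + t v) minus a quadratic in t.  The
    curvature kappa is free: kappa = L gives the upper bound and kappa = - L
    the lower one. *)
Lemma quadratic_remainder kappa x v : exists2 c : R, 0 < c &
  f (x + v) - f x - dot (gradient f x) v - kappa / 2 * dot v v =
  dot (gradient f (x + c *: v) - gradient f x) v - kappa * c * dot v v.
Proof.
set psi := fun t : R => f (x + t *: v)
  - (dot (gradient f x) v * t + kappa / 2 * dot v v * t ^+ 2).
have dpsi : forall s : R, is_derive s 1 psi (dot (gradient f (x + s *: v)) v
  - (dot (gradient f x) v + kappa * dot v v * s)).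
  move=> s; have H := is_derive_line x v s.
  apply: is_derive_eq.
  by rewrite /GRing.scale /=; field.
have cpsi : {within `[0, 1], continuous psi}%classic.
  by apply: derivable_within_continuous => s _; have [] := dpsi s.
have [c] := MVT ltr01 (fun s _ => dpsi s) cpsi.
rewrite in_itv /= => /andP[c0 _] E; exists c => //.
move: E; rewrite /psi scale0r addr0 scale1r dotDl dotNl => E.
lra.
Qed.

Variables (L : R).
Hypothesis flip : forall x y, enorm (gradient f x - gradient f y) <= L * enorm (x - y).

Lemma gradient_line_le x v (c : R) : 0 < c ->
  `|dot (gradient f (x + c *: v) - gradient f x) v| <= L * c * dot v v.
Proof.
move=> c0; set w := _ - _.
have H : enorm w * enorm v <= L * c * dot v v.
  rewrite -enorm_sqr expr2 mulrA; apply: ler_wpM2r; first exact: enorm_ge0.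
  apply: le_trans (flip _ _) _.
  by rewrite addrAC subrr add0r (enormZ _ (ltW c0)) mulrA.
rewrite ler_norml -[- _ <= _]lerN2 opprK -dotNr; apply/andP; split.
  by apply: le_trans (dot_le_enorm _ _) _; rewrite enormN.
exact: le_trans (dot_le_enorm _ _) H.
Qed.

Lemma smooth_upper_bound x v :
  f (x + v) <= f x + dot (gradient f x) v + L / 2 * dot v v.
Proof.
have [c c0 E] := quadratic_remainder L x v.
have := gradient_line_le x v c0; rewrite ler_norml => /andP[_ H]; lra.
Qed.

Lemma smooth_lower_bound x v :
  f x + dot (gradient f x) v - L / 2 * dot v v <= f (x + v).
Proof.
have [c c0 E] := quadratic_remainder (- L) x v.
have := gradient_line_le x v c0; rewrite ler_norml => /andP[H _]; lra.
Qed.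

End Smooth.

(** Replaces a passage to the limit s -> 0+ by an order argument. *)
Lemma le_of_le_add_small (R : realType) (a b K : R) :
  (forall s : R, 0 < s -> s <= 1 -> a <= b + s * K) -> a <= b.
Proof.
move=> H; apply/ler_addgt0Pr => e e0.
have K1 : 0 < 1 + `|K| by rewrite ltr_pwDl.
have s0 : 0 < Num.min 1 (e / (1 + `|K|)) by rewrite lt_min ltr01 divr_gt0.
apply: le_trans (H _ s0 _) _; first by rewrite ge_min lexx.
rewrite lerD2l; apply: le_trans (ler_norm _) _.
rewrite normrM (gtr0_norm s0).
apply: (@le_trans _ _ (e / (1 + `|K|) * `|K|)).
  by apply: ler_wpM2r => //; rewrite ge_min lexx orbT.
by rewrite mulrAC ler_pdivrMr // ler_wpM2l ?(ltW e0) // lerDr.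
Qed.

(** * Inequalities satisfied by (mu, L)-smooth functions *)

Section StronglyConvex.
Variables (R : realType) (n : nat) (mu L : R) (f : 'rV[R]_n -> R).
Hypothesis hf : mu_L_smooth mu L f.

(** Convexity of f - mu/2 |.|^2 between x and x + v bounds f (x + s v) from
    above, and the Lipschitz gradient bounds it from below by
    f x + s g.v - L/2 s^2 |v|^2.  Dividing by s, the two curvatures leave an
    error (L + mu) / 2 * |v|^2 * s, which vanishes with s. *)
Lemma strong_convex_first_order x v :
  f x + dot (gradient f x) v + mu / 2 * dot v v <= f (x + v).
Proof.
have [_ fd flip fconv] := hf.
apply: (@le_of_le_add_small _ _ _ ((L + mu) / 2 * dot v v)) => s s0 s1.
have := fconv (Itv01 (ltW s0) s1) (x + v) x; rewrite !in_setT => /(_ isT isT).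
rewrite convRE /= /unstable.onem.
have -> : conv (Itv01 (ltW s0) s1) ((x + v) : convex_lmodType _) x = x + s *: v.
  rewrite /conv /= /unstable.onem scalerDr scalerBl scale1r addrAC.
  by rewrite addrCA subrr addr0.
rewrite !enorm_sqr => C.
have A := smooth_lower_bound fd flip x (s *: v).
rewrite !dotE (dotC v x) in A C.
rewrite -(ler_pM2l s0); nra.
Qed.

Hypothesis mu0 : 0 <= mu.
Hypothesis muL : mu < L.

(** With p = g_x - g_y and w = x - y, the majorant of f at x minus its minorant
    at y, taken at the common point x + v, is a quadratic in v with leading
    coefficient (L - mu) / 2; its minimizer v = (mu w - p) / (L - mu) makes
    nonnegativity of the difference the claimed inequality. *)
Lemma interpolation_ineq x y :
  0 <= f x - f y - dot (gradient f y) (x - y)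
     - L / (2 * (L - mu)) *
       (L^-1 * dot (gradient f x - gradient f y) (gradient f x - gradient f y)
        + mu * dot (x - y) (x - y)
        - 2 * (mu / L) * dot (gradient f y - gradient f x) (y - x)).
Proof.
have [_ fd flip _] := hf.
have L0 : L != 0 by rewrite gt_eqF ?(le_lt_trans mu0).
have D0 : L - mu != 0 by rewrite subr_eq0 gt_eqF.
set gx := gradient f x; set gy := gradient f y.
pose p := gx - gy; pose w := x - y.
pose v := (L - mu)^-1 *: (mu *: w - p).
have up := smooth_upper_bound fd flip x v.
have := strong_convex_first_order y (w + v).
have -> : y + (w + v) = x + v by rewrite addrA addrCA subrr addr0.
rewrite -/gy => lo.
have Egx : gx = gy + p by rewrite addrCA subrr addr0.
rewrite -/gx Egx in up.
rewrite -[gy - gx]opprB -[y - x]opprB -/p -/w.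
have : 0 <= (f x + dot (gy + p) v + L / 2 * dot v v)
          - (f y + dot gy (w + v) + mu / 2 * dot (w + v) (w + v)).
  by rewrite subr_ge0; apply: le_trans lo up.
congr (0 <= _).
(* p and w must be atoms here, or the expansion splits them further. *)
rewrite /v; clearbody p w; rewrite !dotE (dotC w p); field.
by rewrite D0 L0.
Qed.

(** A gradient step of length 1/L from xs would decrease f by |g|^2 / (2 L). *)
Lemma gradient_at_min xs : (forall y, f xs <= f y) -> gradient f xs = 0.
Proof.
move=> fmin; have [_ fd flip _] := hf.
have L0 : 0 < L by apply: le_lt_trans muL.
set g := gradient f xs.
have := smooth_upper_bound fd flip xs (- (L^-1 *: g)); rewrite -/g !dotE => H.
have {}H := le_trans (fmin _) H.
apply: dot_eq0; apply: le_anti; rewrite dot_ge0 andbT.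
have E : f xs - L^-1 * dot g g + L / 2 * - - (L^-1 * (L^-1 * dot g g))
  = f xs - (2 * L)^-1 * dot g g by field; rewrite gt_eqF.
rewrite E in H.
by rewrite -(pmulr_rle0 _ (_ : 0 < (2 * L)^-1)) ?invr_gt0 ?mulr_gt0 //; lra.
Qed.

(** The three geometric facts on the noisy direction are [slope], [dle] and
    [dge]; [step] is the lower bound on gamma |d|^2 that follows from the
    terminating inequality at eta gamma. *)
Lemma armijo_decrease delta eps eta x gamma d x' :
  0 <= delta < 1 -> 0 < eps -> eps < (1 - delta) / (1 + delta) ^+ 2 -> 0 < eta ->
  noisy_gradient_step delta f x gamma d x' ->
  armijo_terminated eps eta f x gamma d ->
  2 * eps * (1 - delta) ^+ 2 / (eta * L) * ((1 - delta) / (1 + delta) ^+ 2 - eps)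
    * dot (gradient f x) (gradient f x) <= f x - f x'.
Proof.
move=> /andP[de0 de1] eps0 eps1 eta0 [ga0 dn ->] [ar1 ar2].
have [_ fd flip _] := hf.
have L0 : 0 < L by apply: le_lt_trans muL.
set g := gradient f x in dn *.
pose e := d - - g.
have ed : d = e - g by rewrite /e opprK addrK.
rewrite -/e in dn; clearbody e.
have ng := enorm_ge0 g; have ne := enorm_ge0 e; have nd := enorm_ge0 d.
have G2 := enorm_sqr g; have D2 := enorm_sqr d.
have eg : dot e g <= delta * dot g g.
  apply: le_trans (dot_le_enorm _ _) _.
  by rewrite -G2 expr2 mulrA ler_wpM2r.
have eg' : - dot e g <= delta * dot g g.
  rewrite -dotNl; apply: le_trans (dot_le_enorm _ _) _.
  by rewrite enormN -G2 expr2 mulrA ler_wpM2r.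
have ee : dot e e <= delta ^+ 2 * dot g g.
  by rewrite -enorm_sqr -G2 -exprMn ler_pXn2r ?nnegrE ?mulr_ge0.
have g0 := dot_ge0 g.
have slope : (1 - delta) * dot g g <= - dot g d.
  rewrite ed dotDr dotNr (dotC g e); lra.
have dle : dot d d <= (1 + delta) ^+ 2 * dot g g.
  rewrite ed !dotE (dotC g e); clear -eg' ee; nra.
have dge : (1 - delta) ^+ 2 * dot g g <= dot d d.
  rewrite -G2 -D2 -exprMn ler_pXn2r ?nnegrE ?mulr_ge0 ?subr_ge0 ?(ltW de1) //.
  have [g00|gn0] := eqVneq (enorm g) 0; first by rewrite g00 mulr0.
  rewrite -(ler_pM2r (_ : 0 < enorm g)) ?lt_def ?gn0 //.
  rewrite -mulrA -expr2 G2; apply: le_trans slope _; rewrite -dotNl.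
  by apply: le_trans (dot_le_enorm _ _) _; rewrite enormN mulrC.
set r := (1 - delta) / (1 + delta) ^+ 2 in eps1 *.
have sq0 : 0 < (1 + delta) ^+ 2 by rewrite exprn_gt0 // ltr_wpDr.
have angle : r * dot d d <= - dot g d.
  apply: le_trans slope; rewrite /r -mulrA.
  by rewrite ler_wpM2l ?subr_ge0 ?(ltW de1) // mulrC ler_pdivrMr // mulrC.
have step : 2 * (r - eps) * dot d d <= eta * L * (gamma * dot d d).
  have := smooth_upper_bound fd flip x ((eta * gamma) *: d); rewrite -/g !dotE => up.
  have {up} := le_trans ar2 up; rewrite D2 => up.
  have eg0 : 0 < eta * gamma by rewrite mulr_gt0.
  rewrite -(ler_pM2l eg0); nra.
have etaL0 : 0 < eta * L by rewrite mulr_gt0.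
rewrite D2 in ar1.
apply: (@le_trans _ _ (eps * (gamma * dot d d))); last by lra.
rewrite -(ler_pM2l etaL0).
have -> : eta * L * (2 * eps * (1 - delta) ^+ 2 / (eta * L) * (r - eps) * dot g g)
  = eps * (2 * (r - eps) * ((1 - delta) ^+ 2 * dot g g)).
  by field; rewrite !gt_eqF.
rewrite [leRHS]mulrCA ler_pM2l //; apply: le_trans step.
by rewrite ler_wpM2l // mulr_ge0 // subr_ge0 ltW.
Qed.

End StronglyConvex.

(** * Degree one certificates *)

Section Certificate.
Variables (R : realType) (n : nat).

Lemma msize_zX (i : zvar n) : mmeasure mdeg (zX R i) = 2%N.
Proof. by rewrite /zX msizeX mdeg1. Qed.

Lemma mmeasureB_le k (p q : zpoly R n) :
  (mmeasure mdeg p <= k)%N -> (mmeasure mdeg q <= k)%N ->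
  (mmeasure mdeg (p - q) <= k)%N.
Proof.
move=> hp hq; apply: leq_trans (mmeasureD_le _ _ _) _.
by rewrite mmeasureN geq_max hp.
Qed.

(** The squares are those of the coordinates of w, scaled by the square root
    of a. *)
Lemma sos_deg1_dot (a : R) (w : 'rV[zpoly R n]_n) : 0 <= a ->
  (forall j, mmeasure mdeg (w 0%R j) <= 2)%N -> sos_deg1 (a *: dot w w).
Proof.
move=> a0 hw; exists [seq Num.sqrt a *: w 0 j | j <- index_enum 'I_n].
  move=> _ /mapP[j _ ->]; exact: leq_trans (mmeasureZ_le _ _ _) (hw j).
rewrite big_map scaler_sumr; apply: eq_bigr => j _.
by rewrite exprZn sqr_sqrtr // expr2.
Qed.

Lemma sos_deg1_meval_ge0 (v : 'I_#|zvar n| -> R) (p : zpoly R n) :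
  sos_deg1 p -> 0 <= meval v p.
Proof.
move=> [qs _ ->]; rewrite rmorph_sum sumr_ge0 // => q _.
by rewrite rmorphXn sqr_ge0.
Qed.

Lemma meval_dot (v : 'I_#|zvar n| -> R) (a b : 'rV[zpoly R n]_n) :
  meval v (dot a b) = dot (map_mx (meval v) a) (map_mx (meval v) b).
Proof. exact: rmorph_dot. Qed.

(** Collapses the certificate's sum to its two nonzero terms; [i] counts from 0,
    so 4 and 6 are the indices of the fifth and the seventh constraint.  Stated in
    an abstract module, where the simplification does not compute with
    polynomials. *)
Lemma sum_two_terms (V : lmodType R) (a b : R) (h0 h1 h2 h3 h4 h5 h6 : V) :
  \sum_(i < 7) (if (i == 4 :> nat)%N then a else if (i == 6 :> nat)%N then b else 0)
    *: tnth [tuple h0; h1; h2; h3; h4; h5; h6] i = a *: h4 + b *: h6.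
Proof.
by rewrite !big_ord_recl big_ord0 /= !scale0r !add0r !addr0.
Qed.

Lemma armijo_certificate (mu L delta eps eta : R) :
  0 <= mu -> mu < L -> 0 < eta -> 0 < eps ->
  eps < (1 - delta) / (1 + delta) ^+ 2 ->
  sos_certificate_deg1 (constraints n mu L delta eps eta)
   (1 - 4 * mu * eps * (1 - delta) ^+ 2 / (eta * L)
                 * ((1 - delta) / (1 + delta) ^+ 2 - eps)).
Proof.
move=> mu0 muL eta0 eps0 eps1.
have L0 : 0 < L by apply: le_lt_trans muL.
have D0 : 0 < L - mu by rewrite subr_gt0.
set r := (1 - delta) / (1 + delta) ^+ 2 in eps1 *.
pose C := 2 * eps * (1 - delta) ^+ 2 / (eta * L) * (r - eps).
have C0 : 0 <= C.
  apply: mulr_ge0; last by rewrite subr_ge0 ltW.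
  apply: divr_ge0; last by rewrite mulr_ge0 ?(ltW L0) ?(ltW eta0).
  by rewrite mulr_ge0 ?sqr_ge0 // mulr_ge0 ?(ltW eps0).
pose G := gvar R n lk; pose X := xvar R n lk - xvar R n lstar.
exists (fun i : 'I_7 =>
  if (i == 4 :> nat)%N then 2 * mu * C else if (i == 6 :> nat)%N then 1 else 0).
exists ((C * L / (L - mu)) *: dot (G - mpolyC _ mu *: X) (G - mpolyC _ mu *: X)).
split.
- by move=> i; case: ifP => _; [apply: mulr_ge0 => //; apply: mulr_ge0 | case: ifP].
- apply: sos_deg1_dot => [|j].
    apply: divr_ge0; last exact: ltW.
    by apply: mulr_ge0; rewrite ?(ltW L0).
  rewrite !mxE mul_mpolyC; apply: mmeasureB_le; first by rewrite msize_zX.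
  apply: leq_trans (mmeasureZ_le _ _ _) _.
  by apply: mmeasureB_le; rewrite msize_zX.
rewrite sum_two_terms.
rewrite /h_armijo /h_interp -/r -/C -/G.
rewrite [gvar R n lstar]/(0 : 'rV__) sub0r subr0 -[xvar R n lstar - _]opprB -/X.
move: (fvar _ _ lk) (fvar _ _ lk1) (fvar _ _ lstar) => fk fk1 fs.
clearbody G X.
rewrite !dotE (dotC X G) !mul_mpolyC.
(* An identity of linear combinations: it is checked coefficientwise, with the
   scalar products as atoms. *)
move: (dot G G) (dot G X) (dot X X) => gg gx xx.
have -> : 4 * mu * eps * (1 - delta) ^+ 2 / (eta * L) * (r - eps) = 2 * mu * C.
  by rewrite /C; ring.
clearbody C.
apply/mpolyP => m; rewrite !(mcoeffD, mcoeffB, mcoeffN, mcoeffZ).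
by field; rewrite !gt_eqF.
Qed.

(** Isolates the outer shape of [h_interp], with its scalar products as
    variables, so that evaluation does not unfold them. *)
Lemma meval_interp_shape (v : 'I_#|zvar n| -> R) (p q r s1 s2 s3 : zpoly R n)
    (a b c e : R) :
  meval v (p - q - r - a *: (b *: s1 + c *: s2 - e *: s3)) =
  meval v p - meval v q - meval v r
    - a * (b * meval v s1 + c * meval v s2 - e * meval v s3).
Proof. by rewrite !(mevalB, mevalD, mevalZ). Qed.

Section Eval.
Variables (f : 'rV[R]_n -> R) (pt : label -> 'rV[R]_n).
Local Notation ev := (meval (zvalue f pt)).

Lemma ev_fvar i : ev (fvar R n i) = f (pt i).
Proof. by rewrite mevalXU /zvalue enum_rankK. Qed.

Lemma ev_xvar i : map_mx ev (xvar R n i) = pt i.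
Proof. by apply/rowP => j; rewrite !mxE mevalXU /zvalue enum_rankK. Qed.

(* The polynomial vector standing for g_* is 0. *)
Hypothesis gstar : gradient f (pt lstar) = 0.

Lemma ev_gvar i : map_mx ev (gvar R n i) = gradient f (pt i).
Proof.
case: i => [b|]; last by rewrite gstar map_mx0.
by apply/rowP => j; rewrite !mxE mevalXU /zvalue enum_rankK /= mxE.
Qed.

Lemma ev_h_interp mu L i j : mu_L_smooth mu L f -> 0 <= mu -> mu < L ->
  0 <= ev (h_interp n mu L i j).
Proof.
move=> hf mu0 muL; have := interpolation_ineq hf mu0 muL (pt i) (pt j).
rewrite meval_interp_shape !meval_dot !map_mxB.
by rewrite !ev_fvar !ev_xvar !ev_gvar.
Qed.

End Eval.

Lemma certificate_sound (h : 7.-tuple (zpoly R n)) t f (xs xk xk1 : 'rV[R]_n) :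
  sos_certificate_deg1 h t -> valid_at h f xs xk xk1 ->
  f xk1 - f xs <= t * (f xk - f xs).
Proof.
move=> [sigma [sigma0 [sg0 sos E]]] hv.
move/(congr1 (meval (zvalue f (zpoints xs xk xk1)))): E.
rewrite mevalB mevalZ !mevalB mevalD !ev_fvar /= => E.
rewrite -subr_ge0 E addr_ge0 //; first exact: sos_deg1_meval_ge0.
by rewrite rmorph_sum sumr_ge0 // => i _; rewrite /= mevalZ mulr_ge0 ?hv.
Qed.

End Certificate.

Theorem theorem4 (R : realType) (n : nat) (mu L delta eps eta : R)
  (hmu : 0 <= mu) (hmuL : mu < L)
  (hdelta0 : 0 <= delta) (hdelta1 : delta < 1)
  (heps0 : 0 < eps) (heps1 : eps < (1 - delta) / (1 + delta) ^+ 2)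
  (heta : 1 < eta)
  (f : 'rV[R]_n -> R) (hf : mu_L_smooth mu L f)
  (xs : 'rV[R]_n) (hxs : forall y : 'rV[R]_n, f xs <= f y)
  (x d : nat -> 'rV[R]_n) (gamma : nat -> R)
  (hstep : forall k : nat, (1 <= k)%N ->
     noisy_gradient_step delta f (x k) (gamma k) (d k) (x k.+1))
  (harmijo : forall k : nat, (1 <= k)%N ->
     armijo_terminated eps eta f (x k) (gamma k) (d k)) :
  let t := 1 - 4 * mu * eps * (1 - delta) ^+ 2 / (eta * L)
                 * ((1 - delta) / (1 + delta) ^+ 2 - eps) in
  let h := constraints n mu L delta eps eta in
  forall k : nat, (1 <= k)%N ->
    [/\ f (x k.+1) - f xs <= t * (f (x k) - f xs),
        valid_at h f xs (x k) (x k.+1)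
      & sos_certificate_deg1 h t].
Proof.
move=> t h k k1.
have eta0 : 0 < eta by apply: lt_trans heta.
have cert : sos_certificate_deg1 h t by apply: armijo_certificate.
suff hv : valid_at h f xs (x k) (x k.+1).
  by split=> //; apply: certificate_sound cert hv.
have gs : gradient f (zpoints xs (x k) (x k.+1) lstar) = 0.
  exact: (gradient_at_min hf).
case=> [[|[|[|[|[|[|[|//]]]]]]] ?]; rewrite /tnth /=.
1-6: exact: ev_h_interp.
rewrite /h_armijo !(mevalD, mevalN, mevalZ) meval_dot !ev_fvar !ev_gvar //= subr_ge0.
apply: (armijo_decrease hf hmu hmuL _ heps0 heps1 eta0 (hstep k k1) (harmijo k k1)).
by rewrite hdelta0.
Qed.
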